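(* Let $G$ be the graph formed by merging the root of $\mathbb{T}_6$ and the origin of $\mathbb{Z}$ into one vertex. The frog model on $G$ (rooted at the merged vertex, with one sleeping frog at every non-root vertex) is recurrent with probability $p$ satisfying $0<p<1$.
   Context: $\mathbb{T}_6$ is the infinite rooted tree in which every vertex has exactly $6$ children; $\mathbb{Z}$ is the integer line with nearest-neighbor edges; thus the root of $G$ has degree $8$. Frog model on a rooted graph: initially there is one awake frog at the root and one sleeping frog at every other vertex. Awake frogs perform independent simple nearest-neighbor random walks in discrete time. Whenever a vertex is visited for the first time, the frog sleeping there wakes up and begins its own independent simple random walk from that vertex, waking frogs in the same way. A realization is called recurrent if the root is visited infinitely many times (in total, by all frogs). *)

(* Defs.v *)
From HB Require Import structures.
From mathcomp Require Import all_boot all_order all_algebra finmap.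
From mathcomp Require Import all_classical all_reals all_analysis.

Set Implicit Arguments.
Unset Strict Implicit.
Unset Printing Implicit Defensive.

Import Order.TTheory GRing.Theory Num.Theory.

Local Open Scope classical_set_scope.
Local Open Scope ring_scope.

Record rooted_graph := RootedGraph {
  vertex :> countType;
  adj : rel vertex;
  rootv : vertex }.

Arguments adj {_}.

(* A vertex of the d-ary tree is the word of child labels read from the vertex
   back up to the root, so the children of x are the words i :: x. *)
Definition tree_adj (d : nat) : rel (seq 'I_d) := fun x y =>
  [exists i, y == i :: x] || [exists i, x == i :: y].

Definition regular_tree (d : nat) : rooted_graph :=
  @RootedGraph (seq 'I_d) (@tree_adj d) [::].

Definition integer_line : rooted_graph :=
  @RootedGraph int (fun m n => `|m - n| == 1) 0.

(* Merging the roots of G and H: a vertex x of G is encoded as (x, rootv H), a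
   vertex y of H as (rootv G, y), and the merged vertex is (rootv G, rootv H). *)
Section Merge.
Variables G H : rooted_graph.

Definition merge_pred : pred (G * H) :=
  fun v => (v.1 == rootv G) || (v.2 == rootv H).

Definition merge_vertex := {v : G * H | merge_pred v}.

Definition merge_adj : rel merge_vertex := fun v w =>
  [&& (val v).2 == rootv H, (val w).2 == rootv H & adj (val v).1 (val w).1]
  || [&& (val v).1 == rootv G, (val w).1 == rootv G & adj (val v).2 (val w).2].

Lemma merge_root_subproof : merge_pred (rootv G, rootv H).
Proof. by rewrite /merge_pred eqxx. Qed.

Definition merge_root : merge_vertex := exist merge_pred _ merge_root_subproof.

Definition merge_roots : rooted_graph :=
  @RootedGraph merge_vertex merge_adj merge_root.

End Merge.

(* Meaningful for locally finite graphs only: fset_set of an infinite set is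
   the empty fset. *)
Definition degree (G : rooted_graph) (x : G) : nat :=
  #|` fset_set [set y : G | adj x y] |.

Definition srw_step (R : realType) (G : rooted_graph) (x y : G) : R :=
  if adj x y then (degree x)%:R^-1 else 0.

Section Probability.
Context {R : realType} {d : measure_display} {Omega : measurableType d}.
Variable P : probability Omega R.

(* The countable state space carries its discrete sigma-algebra.  The last
   clause is the Markov property with transition kernel srw_step, the
   conditional probability being multiplied out so that histories of
   probability zero need no separate treatment. *)
Definition simple_random_walk (G : rooted_graph) (v : G)
    (X : nat -> Omega -> G) : Prop :=
  [/\ forall n (B : set G), measurable (X n @^-1` B),
      P (X 0%N @^-1` [set v]) = 1%E
    & forall (n : nat) (x : nat -> G),
      P [set w | forall i, (i <= n.+1)%N -> X i w = x i] =
      (P [set w | forall i, (i <= n)%N -> X i w = x i] *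
       (srw_step R (x n) (x n.+1))%:E)%E].

Definition sigma_process (T : Type) (X : nat -> Omega -> T) : set (set Omega) :=
  <<s \bigcup_n preimage_set_system setT (X n) setT >>.

Definition mutually_independent (I : choiceType) (F : I -> set (set Omega)) :
    Prop :=
  forall (J : {fset I}) (E : I -> set Omega),
    (forall j, j \in J -> F j (E j)) ->
    P (\bigcap_(j in [set` J]) E j) = (\prod_(j <- J) P (E j))%E.

End Probability.

(* The frog model driven by one realization of the walks: the frog initially at
   v, once awake, follows the path S v (where S v 0 = v almost surely). *)
Section FrogModel.
Variables (G : rooted_graph) (S : G -> nat -> G).

(* wake_time n v is Some t if the frog initially at v has been woken at some
   time t <= n, and None if it is still asleep at time n.  The frog at u woken
   at time t is at S u (n - t) at time n >= t. *)
Fixpoint wake_time (n : nat) (v : G) : option nat :=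
  match n with
  | 0 => if v == rootv G then Some 0%N else None
  | m.+1 =>
      if wake_time m v is Some t then Some t
      else if `[< exists u t, wake_time m u = Some t /\ S u (m.+1 - t)%N = v >]
           then Some m.+1 else None
  end.

Definition awake_frog_at (u : G) (n : nat) (x : G) : Prop :=
  exists2 t, wake_time n u = Some t & S u (n - t)%N = x.

Definition recurrent : Prop :=
  infinite_set [set un : G * nat | awake_frog_at un.1 un.2 (rootv G)].

End FrogModel.

Definition recurrence_event (Omega : Type) (G : rooted_graph)
    (S : G -> nat -> Omega -> G) : set Omega :=
  [set w | recurrent (fun v n => S v n w)].

Definition T6_merge_Z : rooted_graph := merge_roots (regular_tree 6) integer_line.

(* Main.v *)
(* Recurrence has positive probability.  If the initial frog starts by walking
   to 1 and then 2 on the line, every line vertex n >= 1 is visited as soon as,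
   for each n >= 2, one of the frogs started at 1, ..., n hits n + 1.  By
   gambler's ruin this fails with probability at most n! / (n + 1)^n <= 2^-n,
   and these sum to 1/2.  All frogs started at positive line vertices hit the root almost
   surely, so infinitely many frogs then visit it.

   Recurrence has probability less than one.  If the initial frog first steps
   into the tree and some frog later returns to the root, there is a lineage of
   distinct frogs, each waking the next, whose concatenated path ends at the
   root.  New frogs are woken only by steps away from the root, since the
   ancestors of a visited tree vertex have all been visited.  A union bound over
   lineages is a first-moment computation for a branching random walk, in which
   a^|x| with a = 2/7 is superharmonic; summed over the six possible first steps
   it bounds the probability by 6 * (1/8) * 2a = 3/7 < 6/8. *)
Require Import Defs.
From mathcomp Require Import all_boot all_order all_algebra finmap.
From mathcomp Require Import zify ring lra.
From mathcomp Require Import all_classical all_reals all_analysis.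

Set Implicit Arguments.
Unset Strict Implicit.
Unset Printing Implicit Defensive.

Import Order.TTheory GRing.Theory Num.Theory.

Local Open Scope classical_set_scope.
Local Open Scope ring_scope.

(** * Closure of sigma-algebras and real-valued probabilities *)

Section SigmaAlgebraClosure.
Variables (T : Type) (M : set (set T)).
Hypothesis sigmaM : sigma_algebra setT M.

Lemma sigma_not (A : T -> Prop) :
  M [set w | A w] -> M [set w | ~ A w].
Proof. by case: sigmaM => _ MC _ /MC; rewrite setTD. Qed.

Lemma sigma_exists (I : countType) (A : I -> T -> Prop) :
  (forall i, M [set w | A i w]) -> M [set w | exists i, A i w].
Proof.
case: sigmaM => M0 _ MU MA.
pose F n := if @choice.unpickle I n is Some i then [set w | A i w] else set0.
have -> : [set w | exists i, A i w] = \bigcup_n F n.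
  apply/seteqP; split=> [w [i Aiw]|w [n _]].
    by exists (choice.pickle i) => //; rewrite /F choice.pickleK.
  by rewrite /F; case: choice.unpickle => // i Aiw; exists i.
by apply: MU => n; rewrite /F; case: choice.unpickle.
Qed.

Lemma sigma_forall (I : countType) (A : I -> T -> Prop) :
  (forall i, M [set w | A i w]) -> M [set w | forall i, A i w].
Proof.
move=> MA.
have -> : [set w | forall i, A i w] = [set w | ~ exists i, ~ A i w].
  apply/seteqP; split=> w /= Aw; first by case=> i; exact.
  by move=> i; apply: contrapT => nAi; apply: Aw; exists i.
by apply/sigma_not/sigma_exists => i; exact/sigma_not/MA.
Qed.

Lemma sigma_or (A B : T -> Prop) :
  M [set w | A w] -> M [set w | B w] -> M [set w | A w \/ B w].
Proof.
move=> MA MB.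
have -> : [set w | A w \/ B w] =
          [set w | exists b : bool, (if b then A else B) w].
  apply/seteqP; split=> w /=; first by case; [exists true|exists false].
  by case=> -[]; [left|right].
by apply: sigma_exists => -[].
Qed.

Lemma sigma_and (A B : T -> Prop) :
  M [set w | A w] -> M [set w | B w] -> M [set w | A w /\ B w].
Proof.
move=> MA MB.
have -> : [set w | A w /\ B w] =
          [set w | forall b : bool, (if b then A else B) w].
  apply/seteqP; split=> w /= AB; first by case: AB => ? ? [].
  by split; [exact: (AB true)|exact: (AB false)].
by apply: sigma_forall => -[].
Qed.

Lemma sigma_const (A : Prop) : M [set w | A].
Proof.
case: sigmaM => M0 MC _.
have [a|na] := pselect A.
  have -> : [set w : T | A] = setT `\` set0 by apply/seteqP; split=> w; [split|].
  exact: MC.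
by rewrite (_ : [set w | A] = set0)//; apply/seteqP; split.
Qed.

Lemma sigma_implies (A B : T -> Prop) :
  M [set w | A w] -> M [set w | B w] -> M [set w | A w -> B w].
Proof.
move=> MA MB.
have -> : [set w | A w -> B w] = [set w | ~ A w \/ B w].
  apply/seteqP; split=> w /= => [AB|[nA /nA|]//].
  by have [/AB|] := pselect (A w); [right|left].
by apply: sigma_or => //; exact: sigma_not.
Qed.

End SigmaAlgebraClosure.

Lemma measurable_sigma_algebra d (T : measurableType d) :
  sigma_algebra setT (@measurable d T).
Proof.
split => // [A mA|A mA]; first by rewrite setTD; exact: measurableC.
exact: bigcup_measurable.
Qed.

Section RealProbability.
Context {R : realType} {d : measure_display} {Omega : measurableType d}.
Variable P : probability Omega R.
Implicit Types A B : set Omega.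

Definition pr A : R := fine (P A).

Lemma prE A : measurable A -> P A = (pr A)%:E.
Proof. by move=> mA; rewrite fineK// fin_num_measure. Qed.

Lemma pr_ge0 A : 0 <= pr A.
Proof. exact: fine_ge0. Qed.

Lemma pr_le1 A : measurable A -> pr A <= 1.
Proof. by move=> mA; rewrite -lee_fin -prE//; exact: probability_le1. Qed.

Lemma pr_le A B : measurable A -> measurable B -> A `<=` B -> pr A <= pr B.
Proof. by move=> mA mB AB; rewrite -lee_fin -!prE// le_measure ?inE. Qed.

Lemma pr_set0 : pr set0 = 0.
Proof. by rewrite /pr measure0. Qed.

Lemma prC A : measurable A -> pr (~` A) = 1 - pr A.
Proof.
move=> mA; apply/EFin_inj; rewrite -prE; last exact: measurableC.
by rewrite probability_setC// prE// EFinB.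
Qed.

Lemma prU_le A B : measurable A -> measurable B -> pr (A `|` B) <= pr A + pr B.
Proof.
move=> mA mB; rewrite -lee_fin EFinD -!prE//; last exact: measurableU.
exact: measureU2.
Qed.

Lemma pr_le_add A B C : measurable A -> measurable B -> measurable C ->
  A `<=` B `|` C -> pr A <= pr B + pr C.
Proof.
move=> mA mB mC ABC; apply: le_trans (prU_le mB mC).
by apply: pr_le => //; exact: measurableU.
Qed.

Lemma pr_le_sum (I : eqType) (s : seq I) (F : I -> set Omega) A :
  measurable A -> (forall i, measurable (F i)) ->
  A `<=` [set w | exists2 i, i \in s & F i w] -> pr A <= \sum_(i <- s) pr (F i).
Proof.
elim: s A => [|i s IHs] A mA mF AF.
  rewrite big_nil (_ : A = set0) ?pr_set0//.
  by apply/seteqP; split=> // w /AF[].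
rewrite big_cons.
have mAi : measurable (A `\` F i) by exact: measurableD.
apply: le_trans (@pr_le_add _ (F i) _ _ _ mAi _) _ => //.
  by move=> w Aw; have [|] := pselect (F i w); [left|right].
rewrite lerD2l; apply: IHs => // w [/AF[j]]; rewrite inE => /orP[/eqP->//|js Fj] _.
by exists j.
Qed.

(** Countable subadditivity, the weights [c / 2 ^ n.+1] summing to [c]. The case [c = 0] handles
    countable unions of null events. *)
Lemma pr_bigcup_geometric (c : R) (F : nat -> set Omega) A :
  0 <= c -> measurable A -> (forall n, measurable (F n)) ->
  (forall n, pr (F n) <= c / (2 ^ n.+1)%:R) ->
  A `<=` [set w | exists n, F n w] -> pr A <= c.
Proof.
move=> c0 mA mF Fc AF; rewrite -lee_fin -prE//.
apply: le_trans (epsilon_trick0 xpredT c0).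
have AF' : A `<=` \bigcup_n F n by move=> w /AF[n Fnw]; exists n.
have := measure_sigma_subadditive P mF mA AF'.
move=> /le_trans; apply.
by apply: lee_nneseries => [n _ _|n _]; [exact: measure_ge0|move: (Fc n); rewrite -lee_fin -prE].
Qed.

Lemma pr_exists_nondecreasing (c : R) (F : nat -> set Omega) :
  (forall n, measurable (F n)) -> (forall n, F n `<=` F n.+1) ->
  (forall n, pr (F n) <= c) -> pr [set w | exists n, F n w] <= c.
Proof.
move=> mF ndF Fc.
have -> : [set w | exists n, F n w] = \bigcup_n F n.
  by apply/seteqP; split=> w [n]; [exists n|move=> _ ?; exists n].
have mU : measurable (\bigcup_n F n) by exact: bigcup_measurable.
have ndF' : nondecreasing_seq F.
  by apply/nondecreasing_seqP => n; exact/subsetPset/ndF.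
have := nondecreasing_cvg_mu (mu := P) mF mU ndF'.
rewrite -lee_fin -prE// => /cvg_lim <- //.
apply: lime_le; last by near=> n => /=; rewrite prE// lee_fin.
by apply/cvg_ex; eexists; exact: (nondecreasing_cvg_mu (mu := P)).
Unshelve. all: by end_near. Qed.

Lemma pr_exists_eq0 (I : countType) (F : I -> set Omega) :
  (forall i, measurable (F i)) -> (forall i, pr (F i) = 0) ->
  pr [set w | exists i, F i w] = 0.
Proof.
move=> mF F0; apply/le_anti; rewrite pr_ge0 andbT.
pose H n := if @choice.unpickle I n is Some i then F i else set0.
apply: (@pr_bigcup_geometric _ H) => //.
- by apply: (sigma_exists (@measurable_sigma_algebra _ _)) => i; exact: mF.
- by move=> n; rewrite /H; case: choice.unpickle.
- by move=> n; rewrite mul0r /H; case: choice.unpickle => [i|]; rewrite ?F0 ?pr_set0.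
- by move=> w [i Fi]; exists (choice.pickle i); rewrite /H choice.pickleK.
Qed.

End RealProbability.

(** * Cylinder events of independent walks *)

Section Cylinder.
Variables (T Omega : Type) (X : nat -> Omega -> T).

Definition cylinder (n : nat) (x : nat -> T) : set Omega :=
  [set w | forall i, (i <= n)%N -> X i w = x i].

(** Paths are total functions of which a cylinder reads only a prefix, so the constant tail beyond
    [n.+1] is mere filler. *)
Definition extend (n : nat) (x : nat -> T) (y : T) : nat -> T :=
  fun i => if (i <= n)%N then x i else y.

Lemma extend_last n x y : extend n x y n.+1 = y.
Proof. by rewrite /extend ltnn. Qed.

Lemma cylinder_extend n x y :
  cylinder n.+1 (extend n x y) = cylinder n x `&` [set w | X n.+1 w = y].
Proof.
apply/seteqP; split=> w => [Xw|[Xw Xy] i].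
  split=> [i i_n|]; last by rewrite /= Xw// extend_last.
  by rewrite Xw ?leqW// /extend i_n.
by rewrite leq_eqVlt ltnS /extend => /orP[/eqP->|i_n]; rewrite ?ltnn// i_n Xw.
Qed.

End Cylinder.

Definition is_walk (G : rooted_graph) (v : G) (s : nat -> G) : Prop :=
  s 0%N = v /\ forall n, adj (s n) (s n.+1).

(** An explicit enumeration also certifies local finiteness, without which [degree] would take its
    default value 0. *)
Definition neighbour_list (G : rooted_graph) (nbrs : G -> seq G) : Prop :=
  forall x, uniq (nbrs x) /\ forall y, adj x y = (y \in nbrs x).

Lemma degree_neighbour_list (G : rooted_graph) (nbrs : G -> seq G) (x : G) :
  neighbour_list nbrs -> degree x = size (nbrs x).
Proof.
move=> /(_ x)[nbrs_uniq nbrsP]; rewrite /degree.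
have -> : [set y : G | adj x y] = [set` nbrs x].
  by apply/seteqP; split=> y /=; rewrite nbrsP.
have -> : fset_set [set` nbrs x] = [fset y in nbrs x]%fset.
  apply/fsetP => y; rewrite in_fset_set ?inE; last exact: finite_seq.
  by apply/idP/idP; rewrite ?mem_setE.
by rewrite card_fseq undup_id.
Qed.

Section Process.
Context {R : realType} {d : measure_display} {Omega : measurableType d}.
Variable P : probability Omega R.

Lemma sigma_process_sigma (T : Type) (X : nat -> Omega -> T) :
  sigma_algebra setT (sigma_process X).
Proof. exact: smallest_sigma_algebra. Qed.

Lemma sigma_process_eq (T : Type) (X : nat -> Omega -> T) n y :
  sigma_process X [set w | X n w = y].
Proof.
by apply: sub_sigma_algebra; exists n => //; exists [set y] => //; rewrite setTI.
Qed.

Lemma sigma_process_cylinder (T : Type) (X : nat -> Omega -> T) n x :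
  sigma_process X (cylinder X n x).
Proof.
have sX := sigma_process_sigma X.
apply: (sigma_forall sX) => i; apply: (sigma_implies sX).
  exact: (sigma_const sX).
exact: sigma_process_eq.
Qed.

Lemma sigma_process_measurable (T : Type) (X : nat -> Omega -> T) :
  (forall n B, measurable (X n @^-1` B)) ->
  sigma_process X `<=` @measurable _ Omega.
Proof.
move=> mX; apply: smallest_sub; first exact: measurable_sigma_algebra.
by move=> _ [n _ [B _ <-]]; rewrite setTI; exact: mX.
Qed.

Section SimpleRandomWalk.
Variables (G : rooted_graph) (v : G) (X : nat -> Omega -> G).
Hypothesis walkX : simple_random_walk P v X.

Lemma srw_sub_measurable : sigma_process X `<=` @measurable _ Omega.
Proof. by apply: sigma_process_measurable; case: walkX. Qed.

Lemma srw_measurable_cylinder n x : measurable (cylinder X n x).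
Proof. by apply: srw_sub_measurable; exact: sigma_process_cylinder. Qed.

Lemma pr_cylinder0 : pr P (cylinder X 0 (fun=> v)) = 1.
Proof.
case: walkX => _ Pv _; rewrite /pr (_ : cylinder _ _ _ = X 0%N @^-1` [set v]).
  by rewrite Pv.
by apply/seteqP; split=> w /= => [->//|Xv [|//]].
Qed.

Lemma pr_cylinderS n x :
  pr P (cylinder X n.+1 x) = pr P (cylinder X n x) * srw_step R (x n) (x n.+1).
Proof.
case: walkX => _ _ Pstep; apply/EFin_inj; rewrite EFinM -!prE.
- exact: Pstep.
- exact: srw_measurable_cylinder.
- exact: srw_measurable_cylinder.
Qed.

Lemma pr_cylinder_extend (nbrs : G -> seq G) n x y :
  neighbour_list nbrs -> y \in nbrs (x n) ->
  pr P (cylinder X n.+1 (extend n x y)) =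
  pr P (cylinder X n x) / (size (nbrs (x n)))%:R.
Proof.
move=> nbrsP ynbrs; rewrite pr_cylinderS extend_last /srw_step.
rewrite /extend leqnn (nbrsP _).2 ynbrs (degree_neighbour_list _ nbrsP).
congr (pr P _ * _); apply/seteqP; split=> w Xw i i_n.
  by rewrite Xw// i_n.
by rewrite i_n Xw.
Qed.

Lemma measurable_srw_eq n y : measurable [set w | X n w = y].
Proof. by apply: srw_sub_measurable; exact: sigma_process_eq. Qed.

Lemma measurable_srw (B : G -> Prop) n : measurable [set w | B (X n w)].
Proof. by case: walkX => mX _ _; exact: (mX n B). Qed.

Lemma measurable_srw2 (B : G -> G -> Prop) m n :
  measurable [set w | B (X m w) (X n w)].
Proof.
have sM := measurable_sigma_algebra Omega.
rewrite (_ : [set w | _] = [set w | exists y, X m w = y /\ B y (X n w)]).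
  apply: (sigma_exists sM) => y; apply: (sigma_and sM).
    exact: measurable_srw_eq.
  exact: measurable_srw.
by apply/seteqP; split=> w /= => [?|[y [->]]//]; exists (X m w).
Qed.

Lemma measurable_is_walk : measurable [set w | is_walk v (X^~ w)].
Proof.
have sM := measurable_sigma_algebra Omega.
apply: (sigma_and sM); first exact: measurable_srw_eq.
by apply: (sigma_forall sM) => n; exact: (measurable_srw2 adj).
Qed.

(** A path that is not a walk from [v] shows it in a finite prefix. There are countably many
    prefixes, and a prefix with a step off the edges is null because [srw_step] vanishes there. *)
Lemma pr_not_is_walk : pr P [set w | ~ is_walk v (X^~ w)] = 0.
Proof.
have sM := measurable_sigma_algebra Omega.
(* [None] stands for a wrong starting point, [Some (n, s)] for a prefix [s] whose step from index
   [n] to [n.+1] is not along an edge. *)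
pose F (t : option (nat * seq G)) : set Omega :=
  if t isn't Some (n, s) then [set w | X 0%N w <> v] else
  if adj (nth v s n) (nth v s n.+1) then set0 else cylinder X n.+1 (nth v s).
have mF t : measurable (F t).
  case: t => [[n s]|] /=; last exact/(sigma_not sM)/measurable_srw_eq.
  by case: ifP => // _; exact: srw_measurable_cylinder.
apply/le_anti; rewrite pr_ge0 andbT -(pr_exists_eq0 (P := P) mF); last first.
  case=> [[n s]|] /=.
    case: ifPn => [_|/negPf nadj]; first exact: pr_set0.
    by rewrite pr_cylinderS /srw_step nadj mulr0.
  rewrite -[[set w | _]]/(~` [set w | X 0%N w = v]) prC.
    case: walkX => _ Pv _.
    by rewrite /pr (_ : P [set w | _] = 1%E) ?subrr.
  exact: measurable_srw_eq.
apply: pr_le.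
- exact/(sigma_not sM)/measurable_is_walk.
- by apply: (sigma_exists sM) => t; exact: mF.
move=> w /= /not_andP[X0|]; first by exists None.
move=> /existsNP[n /negP/negPf nadj].
exists (Some (n, [seq X i w | i <- iota 0 n.+2])).
have nthX i : (i < n.+2)%N -> nth v [seq X i w | i <- iota 0 n.+2] i = X i w.
  by move=> i_n; rewrite (nth_map 0%N) ?size_iota// nth_iota.
by rewrite /F !nthX// nadj => i i_n; rewrite nthX.
Qed.

End SimpleRandomWalk.

Section IndependentWalks.
Variables (G : rooted_graph) (S : G -> nat -> Omega -> G).
Hypothesis walkS : forall v, simple_random_walk P v (S v).
Hypothesis indepS : mutually_independent P (fun v => sigma_process (S v)).

Definition all_walks : set Omega := [set w | forall v, is_walk v ((S v)^~ w)].

Lemma measurable_all_walks : measurable all_walks.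
Proof.
apply: (sigma_forall (measurable_sigma_algebra Omega)) => v.
exact: measurable_is_walk.
Qed.

Lemma pr_not_all_walks : pr P (~` all_walks) = 0.
Proof.
have sM := measurable_sigma_algebra Omega.
rewrite (_ : ~` _ = [set w | exists v, ~ is_walk v ((S v)^~ w)]).
  apply: pr_exists_eq0 => v; last exact: pr_not_is_walk.
  exact/(sigma_not sM)/measurable_is_walk.
by apply/seteqP; split=> w /=; rewrite existsNP.
Qed.

Definition joint_event (J : {fset G}) (E : G -> set Omega) : set Omega :=
  \bigcap_(j in [set` J]) E j.

Lemma joint_event_ext (J : {fset G}) (E E' : G -> set Omega) :
  (forall j, j \in J -> E j = E' j) -> joint_event J E = joint_event J E'.
Proof. by move=> EE'; apply: eq_bigcapr => j /EE'. Qed.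

Lemma joint_eventU1 u (J : {fset G}) (E : G -> set Omega) :
  joint_event (u |` J)%fset E = joint_event J E `&` E u.
Proof.
apply/seteqP; split=> w => [JEw|[JEw Euw] j /=].
  split; first by move=> j jJ; apply: JEw; rewrite /= in_fsetU jJ orbT.
  by apply: JEw; rewrite /= fset1U1.
by rewrite in_fset1U => /orP[/eqP->//|]; exact: JEw.
Qed.

Lemma measurable_joint_event (J : {fset G}) (E : G -> set Omega) :
  (forall j, j \in J -> sigma_process (S j) (E j)) ->
  measurable (joint_event J E).
Proof.
move=> FE; apply: fin_bigcap_measurable => // j jJ.
by apply: (srw_sub_measurable (walkS j)); exact: FE.
Qed.

Lemma pr_joint_event (J : {fset G}) (E : G -> set Omega) :
  (forall j, j \in J -> sigma_process (S j) (E j)) ->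
  pr P (joint_event J E) = \prod_(j <- J) pr P (E j).
Proof.
move=> FE; apply/EFin_inj; rewrite -prE; last exact: measurable_joint_event.
rewrite indepS// -prodEFin; apply: eq_big_seq => j jJ.
by apply: prE; apply: (srw_sub_measurable (walkS j)); exact: FE.
Qed.

(** The product formula is applied to [J] with [u] added and to [J] alone, and the two products are
    compared. *)
Lemma pr_joint_event_indep (J : {fset G}) (E : G -> set Omega) u B :
  (forall j, j \in J -> sigma_process (S j) (E j)) -> u \notin J ->
  sigma_process (S u) B ->
  pr P (joint_event J E `&` B) = pr P (joint_event J E) * pr P B.
Proof.
move=> FE uJ FB; pose E' j := if j == u then B else E j.
have E'E j : j \in J -> E j = E' j.
  by move=> jJ; rewrite /E'; case: eqP jJ uJ => // -> ->.
have E'u : E' u = B by rewrite /E' eqxx.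
have FE' j : j \in (u |` J)%fset -> sigma_process (S j) (E' j).
  by rewrite in_fset1U /E'; case: eqP => [->|_ /FE].
rewrite (joint_event_ext E'E) -[in LHS]E'u -joint_eventU1 pr_joint_event//.
rewrite big_fsetU1//= E'u mulrC pr_joint_event// => j jJ.
by apply: FE'; rewrite in_fset1U jJ orbT.
Qed.

(** First-step decomposition in the form of a union bound: inside [all_walks] the next position is
    one of finitely many neighbours. *)
Lemma pr_cylinder_step (nbrs : G -> seq G) (A B : set Omega) u n x :
  neighbour_list nbrs -> measurable A -> measurable B -> B `<=` all_walks ->
  pr P (A `&` cylinder (S u) n x `&` B) <=
  \sum_(y <- nbrs (x n)) pr P (A `&` cylinder (S u) n.+1 (extend n x y) `&` B).
Proof.
move=> nbrsP mA mB Bwalk; apply: pr_le_sum => [|y|w [[Aw Cw] Bw]].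
- by do 2!apply: measurableI => //; exact: (srw_measurable_cylinder (walkS u)).
- by do 2!apply: measurableI => //; exact: (srw_measurable_cylinder (walkS u)).
exists (S u n.+1 w).
  by rewrite -(nbrsP _).2 -(Cw n)//; exact: (Bwalk w Bw u).2.
by do 2!split=> //; rewrite cylinder_extend.
Qed.

End IndependentWalks.
End Process.

(** * Dynamics and measurability of the frog model *)

Section FrogDynamics.
Variables (G : rooted_graph) (s : G -> nat -> G).
Hypothesis s0 : forall v, s v 0%N = v.

Lemma wake_time_add n m v t :
  wake_time s n v = Some t -> wake_time s (n + m) v = Some t.
Proof. by move=> Wn; elim: m => [|m IHm]; rewrite ?addn0 ?addnS//= IHm. Qed.

Lemma wake_time_Some n v t :
  wake_time s n v = Some t -> (t <= n)%N /\ wake_time s t v = Some t.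
Proof.
elim: n => [|n IHn] /=; first by case: eqP => // -> [<-]; rewrite /= eqxx.
case W: (wake_time s n v) IHn => [t'|] IHn; first by move=> /IHn[/leqW].
case: asboolP => // Q [<-]; split=> //=.
by rewrite W; case: asboolP.
Qed.

Lemma wake_time_root n : wake_time s n (rootv G) = Some 0%N.
Proof. by elim: n => [|n IHn] /=; [rewrite eqxx|rewrite IHn]. Qed.

(** A frog woken at time [n] itself stands at its own vertex, by [s0]; a frog woken earlier is a
    witness for the waking clause at time [n]. *)
Lemma wake_time_visit n u t :
  wake_time s n u = Some t -> wake_time s n (s u (n - t)%N) <> None.
Proof.
case: n => [|n] /= Wu.
  by move: Wu; case: eqP => // -> [<-]; rewrite s0 eqxx.
case W: (wake_time s n u) Wu => [t'|].
  move=> [<-]; case: (wake_time s n (s u _)) => [//|].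
  by case: asboolP => // -[]; exists u, t'.
by case: asboolP => // Q [<-]; rewrite subnn s0 W; case: asboolP.
Qed.

Lemma not_recurrent :
  (forall n u, (0 < n)%N -> ~ awake_frog_at s u n (rootv G)) -> ~ recurrent s.
Proof.
move=> noret; apply.
apply: (sub_finite_set (B := [set (rootv G, 0%N)])) => // -[u [|n]] /=.
  by case=> t /=; case: eqP => // -> _ _.
by move=> /noret -/(_ isT).
Qed.
End FrogDynamics.

(** Infinitude becomes a countable intersection of countable unions, the form in which recurrence is
    seen to be measurable. *)
Lemma infinite_set_pickleP (T : countType) (A : set T) :
  infinite_set A <-> forall N, exists x, (N <= choice.pickle x)%N /\ A x.
Proof.
split=> [Ainf N|AN /finite_seqP[r Ar]].
  apply: contrapT => noA; apply: Ainf.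
  apply: (@sub_finite_set _ _ (@choice.pickle T @^-1` `I_N)).
    by move=> x Ax /=; rewrite ltnNge; apply/negP => Nx; apply: noA; exists x.
  apply: finite_preimage => // x y _ _; exact: (pcan_inj choice.pickleK).
have [x []] := AN (\max_(x <- r) choice.pickle x).+1.
rewrite Ar /= => + xr; apply/negP; rewrite -leqNgt.
exact: leq_bigmax_seq.
Qed.

Section FrogMeasurability.
Context {d : measure_display} {Omega : measurableType d}.
Variables (G : rooted_graph) (S : G -> nat -> Omega -> G).
Hypothesis mS : forall v n x, measurable [set w | S v n w = x].

Let sM := measurable_sigma_algebra Omega.
Let s w v n := S v n w.

Lemma measurable_wake_time n v (o : option nat) :
  measurable [set w | wake_time (s w) n v = o].
Proof.
elim: n v o => [|n IHn] v o.
  exact: (sigma_const sM ((if v == rootv G then Some 0%N else None) = o)).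
pose Q w := exists u t, wake_time (s w) n u = Some t /\ S u (n.+1 - t)%N w = v.
have mQ : measurable [set w | Q w].
  apply: (sigma_exists sM) => u; apply: (sigma_exists sM) => t.
  by apply: (sigma_and sM); [exact: IHn|exact: mS].
rewrite (_ : [set w | _] = [set w |
    (exists t, wake_time (s w) n v = Some t /\ Some t = o) \/
    wake_time (s w) n v = None /\
      (Q w /\ Some n.+1 = o \/ ~ Q w /\ None = o)]).
  apply: (sigma_or sM).
    apply: (sigma_exists sM) => t; apply: (sigma_and sM); first exact: IHn.
    exact: (sigma_const sM).
  apply: (sigma_and sM); first exact: IHn.
  apply: (sigma_or sM); apply: (sigma_and sM) => //; try exact: (sigma_const sM).
  exact: (sigma_not sM).
apply/seteqP; split=> w /=.
  case W: (wake_time (s w) n v) => [t|]; first by left; exists t.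
  by case: asboolP => Qw <-; right; split=> //; [left|right].
case=> [[t [-> //]]|[-> [[Qw <-]|[nQw <-]]]].
  by case: asboolP.
by case: asboolP.
Qed.

Lemma measurable_recurrence_event : measurable (recurrence_event S).
Proof.
rewrite (_ : recurrence_event S = [set w | forall N, exists un : G * nat,
    (N <= choice.pickle un)%N /\
    exists t, wake_time (s w) un.2 un.1 = Some t /\ s w un.1 (un.2 - t)%N = rootv G]).
  apply: (sigma_forall sM) => N; apply: (sigma_exists sM) => un.
  apply: (sigma_and sM); first exact: (sigma_const sM).
  apply: (sigma_exists sM) => t; apply: (sigma_and sM); last exact: mS.
  exact: measurable_wake_time.
apply/seteqP; split=> w /=.
  move=> /infinite_set_pickleP rec N; have [un [Nun [t Wt St]]] := rec N.
  by exists un; split=> //; exists t.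
move=> rec; apply/infinite_set_pickleP => N; have [un [Nun [t [Wt St]]]] := rec N.
by exists un; split=> //; exists t.
Qed.

End FrogMeasurability.

(** * The graph T_6 merged with Z *)

Local Notation G := T6_merge_Z.

Lemma tree_vertex_subproof (p : seq 'I_6) :
  @merge_pred (regular_tree 6) integer_line (p, 0).
Proof. by rewrite /merge_pred eqxx orbT. Qed.

Lemma line_vertex_subproof (m : int) :
  @merge_pred (regular_tree 6) integer_line ([::], m).
Proof. by rewrite /merge_pred eqxx. Qed.

Definition tree_vertex (p : seq 'I_6) : G := 
  exist (@merge_pred (regular_tree 6) integer_line) _ (tree_vertex_subproof p).

Definition line_vertex (m : int) : G := 
  exist (@merge_pred (regular_tree 6) integer_line) _ (line_vertex_subproof m).

Definition word (x : G) : seq 'I_6 := (val x).1.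

Lemma tree_vertex_inj : injective tree_vertex.
Proof. by move=> p q /(congr1 val)[]. Qed.

Lemma line_vertex_inj : injective line_vertex.
Proof. by move=> m n /(congr1 val)[]. Qed.

Lemma tree_vertex_nil : tree_vertex [::] = rootv G.
Proof. exact: val_inj. Qed.

Lemma line_vertex0 : line_vertex 0 = rootv G.
Proof. exact: val_inj. Qed.

Variant vertex_spec : G -> Type :=
  | TreeVertex i p : vertex_spec (tree_vertex (i :: p))
  | LineVertex m : vertex_spec (line_vertex m).

Lemma vertexP x : vertex_spec x.
Proof.
case: x => -[p m] pm; case: p pm => [|i p] pm.
  by rewrite (_ : exist _ _ _ = line_vertex m); [constructor|exact: val_inj].
rewrite (_ : exist _ _ _ = tree_vertex (i :: p)); first by constructor.
by apply: val_inj; move: (pm); rewrite /merge_pred /= => /eqP ->.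
Qed.

Definition neighbours (x : G) : seq G :=
  match (val x).1 with
  | i :: p =>
      tree_vertex p :: [seq tree_vertex (j :: i :: p) | j <- enum 'I_6]
  | [::] =>
      [:: line_vertex ((val x).2 + 1); line_vertex ((val x).2 - 1)] ++
      if (val x).2 == 0 then [seq tree_vertex [:: j] | j <- enum 'I_6] else [::]
  end.

Lemma neighbour_list_neighbours : neighbour_list neighbours.
Proof.
have tree_uniq p : uniq [seq tree_vertex (j :: p) | j <- enum 'I_6].
  by rewrite map_inj_uniq ?enum_uniq// => j k /tree_vertex_inj[].
have mem_tree p q : (tree_vertex q \in [seq tree_vertex (j :: p) | j <- enum 'I_6])
    = [exists j, q == j :: p].
  apply/mapP/existsP => [[j _ /tree_vertex_inj ->]|[j /eqP ->]]; exists j => //.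
  by rewrite mem_enum.
have mem_line p m : (line_vertex m \in [seq tree_vertex (j :: p) | j <- enum 'I_6])
    = false.
  by apply/mapP => -[j _ /(congr1 val)[]].
move=> x; split.
  case: (vertexP x) => [i p|m]; rewrite /neighbours /=.
    rewrite tree_uniq andbT mem_tree; apply/existsP => -[j /eqP/(congr1 size)/=].
    by lia.
  case: ifP => [/eqP ->|_]; last by rewrite /= !inE (inj_eq line_vertex_inj); lia.
  by rewrite /= !inE (inj_eq line_vertex_inj) !mem_line /= tree_uniq.
have tv_lv i p m : (tree_vertex (i :: p) == line_vertex m) = false.
  by apply/eqP => /(congr1 val).
have lv_tv p n : (line_vertex n == tree_vertex p) = (n == 0) && (p == [::]).
  apply/eqP/andP => [/(congr1 val)[<- ->]//|[/eqP-> /eqP->]].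
  by rewrite tree_vertex_nil line_vertex0.
move=> y; rewrite [adj _ _]/= /merge_adj /neighbours.
case: (vertexP x) => [i p|m]; case: (vertexP y) => [j q|n] /=.
- rewrite orbF inE mem_tree (inj_eq tree_vertex_inj) /tree_adj orbC.
  congr (_ || _).
  by apply/existsP/eqP => [[k /eqP[_ ->//]]|->]; exists i.
- rewrite orbF inE mem_line orbF lv_tv; congr (_ && _).
  apply/orP/eqP => [[]/existsP[k /eqP]//[_ ->//]|->].
  by right; apply/existsP; exists i.
- rewrite orbF !inE !tv_lv /=; case: eqP => // _; rewrite mem_tree.
  apply/orP/existsP => [[/existsP[k /eqP ->]|/existsP[k /eqP]//]|[k /eqP ->]].
    by exists k.
  by left; apply/existsP; exists k.
rewrite (_ : tree_adj [::] [::] = false); last first.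
  by apply/norP; split; apply/existsP => -[k].
rewrite !andbF /= !inE !(inj_eq line_vertex_inj).
rewrite (_ : (_ \in if _ then _ else _) = false) ?orbF; last by case: ifP.
by apply/idP/idP; lia.
Qed.

Lemma size_neighbours_tree i p : size (neighbours (tree_vertex (i :: p))) = 7.
Proof. by rewrite /neighbours /= size_map size_enum_ord. Qed.

Lemma neighbours_root : neighbours (rootv G) =
  [:: line_vertex 1; line_vertex (-1)] ++ [seq tree_vertex [:: j] | j <- enum 'I_6].
Proof. by []. Qed.

Lemma size_neighbours_root : size (neighbours (rootv G)) = 8.
Proof. by rewrite neighbours_root size_cat size_map size_enum_ord. Qed.

Lemma neighbours_line m : m != 0 ->
  neighbours (line_vertex m) = [:: line_vertex (m + 1); line_vertex (m - 1)].
Proof. by rewrite /neighbours /= => /negPf->. Qed.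

(** * Hitting probabilities on the half-line *)

(** The error term decays like [1 / T]; any [T] above [K * b / e] brings it below [e]. *)
Lemma le_of_le_harmonic (R : realType) (p q K b : R) : 0 < K -> 0 <= b ->
  (forall T : nat, p <= q + K / (K + T%:R) * b) -> p <= q.
Proof.
move=> K0 b0 pq; apply/ler_addgt0Pr => e e0.
have /archi_boundP : 0 <= K * b / e.
  by apply: divr_ge0; [apply: mulr_ge0 => //|]; exact: ltW.
set T := Num.bound _ => ltT; apply: (le_trans (pq T)); rewrite lerD2l.
have T0 : 0 <= T%:R :> R by exact: ler0n.
rewrite mulrAC ler_pdivrMr; last by lra.
move: ltT; rewrite ltr_pdivrMr// => ltT.
rewrite mulrDr; nra.
Qed.

Section Hitting.
Context {R : realType} {d : measure_display} {Omega : measurableType d}.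
Variable P : probability Omega R.
Variable S : G -> nat -> Omega -> G.
Hypothesis walkS : forall v, simple_random_walk P v (S v).

Definition never_hits (u a : G) : set Omega := [set w | forall k, S u k w <> a].

Lemma sigma_process_never_hits u a : sigma_process (S u) (never_hits u a).
Proof.
have sS := sigma_process_sigma (S u).
by apply: (sigma_forall sS) => k; apply: (sigma_not sS); exact: sigma_process_eq.
Qed.

Lemma measurable_never_hits u a : measurable (never_hits u a).
Proof.
by apply: (srw_sub_measurable (walkS u)); exact: sigma_process_never_hits.
Qed.

Section Strip.
Variables (u a : G) (N : nat) (q : nat -> R).
Hypothesis q_ge0 : forall m, (m <= N)%N -> 0 <= q m.
Hypothesis q_harmonic : forall m, (0 < m < N)%N -> q m.+1 + q m.-1 = 2 * q m.
Hypothesis q_ends : forall m, m = 0%N \/ m = N -> line_vertex m <> a -> 1 <= q m.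

(** The expected exit time of the walk from the strip [0 .. N] is [m * (N - m)], whence [b]. The
    constant [K] dominates [b], and [c T] decreases from 1 to 0. *)
Let K : R := N%:R ^+ 2 + 1.
Let c (T : nat) : R := K / (K + T%:R).
Let b (m : nat) : R := m%:R * (N%:R - m%:R) + 1.

(* The mean of [b] over the two neighbours of [m] is [b m - 1], so this makes
   [q m + c T * b m] an upper bound that is stable under one step of the walk. *)
Lemma strip_decay T m : (m <= N)%N -> c T * (b m - 1) <= c T.+1 * b m.
Proof.
rewrite -(ler_nat R) /c /b /K => mN.
have m0 : 0 <= m%:R :> R by exact: ler0n.
have T0 : 0 <= T%:R :> R by exact: ler0n.
have N0 : 0 <= N%:R :> R by exact: ler0n.
set B := m%:R * _ + 1; set k := N%:R ^+ 2 + 1.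
have Bk : B <= k by rewrite lerD2r; nra.
have k0 : 0 < k by rewrite ltr_wpDl// sqr_ge0.
rewrite -natr1 -subr_ge0.
have -> : k / (k + (T%:R + 1)) * B - k / (k + T%:R) * (B - 1) =
          k * (k + T%:R + 1 - B) / ((k + T%:R) * (k + (T%:R + 1))).
  by field; apply/andP; split; rewrite gt_eqF//; lra.
by rewrite divr_ge0// ?mulr_ge0//; lra.
Qed.
(** Induction on the horizon [T]. The term [q m] pays for leaving the strip at the wrong end, and
    [c T * b m] for staying inside for [T] steps; at [T = 0] the latter is at least 1. *)
Lemma pr_cylinder_never_hits T n x (m : nat) : (m <= N)%N -> x n = line_vertex m ->
  pr P (cylinder (S u) n x `&` (never_hits u a `&` all_walks S)) <=
  pr P (cylinder (S u) n x) * (q m + c T * b m).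
Proof.
have mB : measurable (never_hits u a `&` all_walks S).
  apply: measurableI; first exact: measurable_never_hits.
  exact: (measurable_all_walks walkS).
have mC n' x' : measurable (cylinder (S u) n' x').
  exact: (srw_measurable_cylinder (walkS u)).
have c0 T' : 0 <= c T' by rewrite divr_ge0// ?addr_ge0// ?sqr_ge0.
have b1 m' : (m' <= N)%N -> 1 <= b m'.
  by move=> mN; rewrite lerDr mulr_ge0// subr_ge0 ler_nat.
have ge1_bound n' x' r : 1 <= r ->
    pr P (cylinder (S u) n' x' `&` (never_hits u a `&` all_walks S)) <=
    pr P (cylinder (S u) n' x') * r.
  move=> r1; apply: le_trans (ler_peMr (pr_ge0 _ _) r1).
  apply: pr_le => //; first exact: measurableI.
elim: T n x m => [|T IHT] n x m mN xn.
  apply: (ge1_bound n x); have := b1 _ mN; have := q_ge0 mN.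
  rewrite /c addr0 divff ?mul1r; first by lra.
  by rewrite gt_eqF// ltr_wpDl// sqr_ge0.
(* At an end of the strip, either the target is reached and the event is empty, or [q m] is at least
   1 and the bound is trivial. *)
have [mI|mE] := boolP (0 < m < N)%N; last first.
  have {}mE : m = 0%N \/ m = N by lia.
  have [lva|] := pselect (line_vertex m = a).
    rewrite (_ : _ `&` _ = set0); last first.
      apply/seteqP; split=> // w [Cw [Nw _]]; apply: (Nw n).
      by rewrite Cw// xn.
    rewrite pr_set0 mulr_ge0 ?pr_ge0// addr_ge0 ?q_ge0// mulr_ge0//.
    exact: le_trans (b1 _ mN).
  move=> /(q_ends mE) q1; apply: (ge1_bound n x); have := b1 _ mN; have := c0 T.+1.
  by nra.
have := pr_cylinder_step walkS u n x neighbour_list_neighbours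
  measurableT mB (@subIsetr _ _ _).
under eq_bigr do rewrite setTI.
rewrite setTI xn neighbours_line; last by lia.
move=> /le_trans; apply.
have mS : line_vertex (m%:Z + 1) = line_vertex m.+1 by congr line_vertex; lia.
have mP : line_vertex (m%:Z - 1) = line_vertex m.-1 by congr line_vertex; lia.
rewrite mS mP !big_cons big_nil addr0.
have step (m' : nat) : line_vertex m' \in neighbours (x n) -> (m' <= N)%N ->
    pr P (cylinder (S u) n.+1 (extend n x (line_vertex m'))
          `&` (never_hits u a `&` all_walks S)) <=
    pr P (cylinder (S u) n x) / 2 * (q m' + c T * b m').
  move=> lv_nbr mN'; apply: (le_trans (IHT _ _ m' mN' (extend_last _ _ _))).
  rewrite (pr_cylinder_extend (walkS u) neighbour_list_neighbours lv_nbr).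
  by rewrite xn neighbours_line//; lia.
have xn' : neighbours (x n) = [:: line_vertex m.+1; line_vertex m.-1].
  by rewrite xn neighbours_line ?mS ?mP//; lia.
have := step m.+1; have := step m.-1; rewrite xn' !inE !eqxx orbT.
move=> /(_ isT) stepP /(_ isT) stepS.
apply: (le_trans (lerD (stepS _) (stepP _))); [lia|lia|].
have := strip_decay T mN; have := q_harmonic mI.
have -> : b m.+1 = b m + N%:R - 2 * m%:R - 1 by rewrite /b -natr1; lra.
have -> : b m.-1 = b m - N%:R + 2 * m%:R - 1.
  by rewrite /b -subn1 natrB; [lra|lia].
have := pr_ge0 P (cylinder (S u) n x); set p := pr _ _ => p0 qE cb.
rewrite -mulrDr -mulrA ler_wpM2l//.
by lra.
Qed.

Lemma pr_never_hits (m : nat) : u = line_vertex m -> (m <= N)%N ->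
  pr P (never_hits u a) <= q m.
Proof.
move=> uE mN; have mW := measurable_all_walks walkS.
have mH : measurable (never_hits u a) by exact: measurable_never_hits.
have mC := srw_measurable_cylinder (walkS u) 0 (fun=> u).
apply: (@le_of_le_harmonic _ _ _ K (b m)).
- by rewrite ltr_wpDl// sqr_ge0.
- by rewrite addr_ge0// mulr_ge0// subr_ge0 ler_nat.
move=> T; have /= := @pr_cylinder_never_hits T 0%N (fun=> u) m mN uE.
rewrite (pr_cylinder0 (walkS u)) mul1r; apply: le_trans.
rewrite -[leRHS]add0r -(pr_not_all_walks walkS); apply: pr_le_add => //.
- exact: measurableC.
- by do 2!apply: measurableI => //.
move=> w Hw; have [Ww|] := pselect (all_walks S w); [right|by left].
by split=> // i; rewrite leqn0 => /eqP->; exact: (Ww u).1.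
Qed.

End Strip.

(** Gambler's ruin: [1 - m / n] is harmonic, equal to 1 at the wrong end 0 and to 0 at the target
    [n]. *)
Lemma pr_never_hits_right (j n : nat) : (j <= n)%N ->
  pr P (never_hits (line_vertex j) (line_vertex n)) <= 1 - j%:R / n%:R.
Proof.
move=> jn; have [n0|n0] := posnP n.
  (* The inverse of 0 is 0, so the claimed bound is 1. *)
  by rewrite n0 invr0 mulr0 subr0; apply: pr_le1; exact: measurable_never_hits.
have n0' : 0 < n%:R :> R by rewrite ltr0n.
apply: (@pr_never_hits _ _ n (fun j => 1 - j%:R / n%:R)) => //.
- by move=> m mn; rewrite subr_ge0 ler_pdivrMr// mul1r ler_nat.
- case=> // m _ /=; rewrite -natr1; lra.
- by move=> m [->|->]//; rewrite mul0r subr0.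
Qed.

(** Gambler's ruin on the strip up to [j + T + 1]: the far end comes before the root with
    probability at most [j / (j + T + 1)], which vanishes as [T] grows. *)
Lemma pr_never_hits_root (j : nat) :
  pr P (never_hits (line_vertex j) (rootv G)) = 0.
Proof.
apply/le_anti; rewrite pr_ge0 andbT.
apply: (@le_of_le_harmonic _ _ _ 1 j%:R) => // T.
apply: (@le_trans _ _ (j%:R / (j + T).+1%:R)).
  apply: (@pr_never_hits _ _ (j + T).+1 (fun m => m%:R / (j + T).+1%:R)) => //.
  - case=> // m _ /=; rewrite -mulrDl mulrA; congr (_ / _).
    by rewrite -[m.+2%:R]natr1 -[m.+1%:R]natr1; lra.
  - move=> m [->|->]; first by rewrite line_vertex0.
    by rewrite divff// pnatr_eq0.
  - by rewrite leqW// leq_addr.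
rewrite add0r mul1r mulrC nat1r ler_wpM2r// lef_pV2 ?posrE ?ltr0n//.
by rewrite ler_nat ltnS leq_addl.
Qed.

End Hitting.

(** * Recurrence has positive probability *)

Section LineActivation.
Variable s : G -> nat -> G.
Hypothesis s0 : forall v, s v 0%N = v.

Definition eventually_awake (v : G) : Prop := exists n t, wake_time s n v = Some t.

Lemma eventually_awake_visit u k :
  eventually_awake u -> eventually_awake (s u k).
Proof.
move=> [n [t /wake_time_Some[_ /(wake_time_add k) /(wake_time_visit s0)]]].
rewrite addKn => Wv; exists (t + k)%N.
by case: wake_time Wv => // t' _; exists t'.
Qed.

(** By induction every positive line vertex is woken, each one beyond 2 being hit by a frog from an
    earlier vertex. All these frogs visit the root, and distinct frogs give distinct pairs in the
    recurrence set. *)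
Lemma recurrent_line :
  s (rootv G) 1%N = line_vertex 1%N -> s (rootv G) 2%N = line_vertex 2%N ->
  (forall n, (1 < n)%N -> exists2 j : nat, (0 < j <= n)%N &
     exists k, s (line_vertex j) k = line_vertex n.+1) ->
  (forall j : nat, (0 < j)%N -> exists k, s (line_vertex j) k = rootv G) ->
  recurrent s.
Proof.
move=> s1 s2 hit_next hit_root.
have root_awake : eventually_awake (rootv G).
  by exists 0%N, 0%N; exact: wake_time_root.
have line_awake n : forall j : nat, (0 < j <= n.+2)%N ->
    eventually_awake (line_vertex j).
  elim: n => [|n IHn] j jn.
    have [->|->] : j = 1%N \/ j = 2%N by lia.
      by rewrite -s1; exact: eventually_awake_visit.
    by rewrite -s2; exact: eventually_awake_visit.
  have [jn'|jn'] := leqP j n.+2; first by apply: IHn; lia.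
  have -> : j = n.+3 by lia.
  have [//|i i_n [k <-]] := hit_next n.+2.
  by apply: eventually_awake_visit; exact: IHn.
rewrite /recurrent => /(finite_image fst) fin.
apply: infinite_nat.
rewrite (_ : setT = (fun j : nat => line_vertex j.+1) @^-1` (fst @`
    [set un : G * nat | awake_frog_at s un.1 un.2 (rootv G)])).
  by apply: finite_preimage => // i j _ _ /line_vertex_inj; lia.
apply/seteqP; split=> // j _ /=.
have [|n [t /wake_time_Some[_ Wt]]] := line_awake j j.+1; first by lia.
have [//|k sk] := hit_root j.+1.
exists (line_vertex j.+1, (t + k)%N) => //=; exists t; last by rewrite addKn.
exact: wake_time_add.
Qed.

End LineActivation.

(** [bernoulli] is [(1 + 1 / a) ^ k >= 1 + k / a] with denominators cleared. At [a = k = n.+1] it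
    gives the factor 2 gained at each step of the induction. *)
Lemma fact_pow2_le n : (n`! * 2 ^ n <= n.+1 ^ n)%N.
Proof.
have bernoulli a k : (a ^ k * (a + k) <= a * a.+1 ^ k)%N.
  elim: k => [|k IHk]; first by rewrite !expn0; lia.
  rewrite !expnS; move: IHk; set u := (a ^ k)%N; set v := (a.+1 ^ k)%N.
  by nia.
elim: n => [//|n IHn]; rewrite factS expnS.
have /= := bernoulli n.+1 n.+1; rewrite addnn -muln2 mulnCA leq_pmul2l//.
apply: leq_trans; rewrite expnS.
by move: IHn; set u := n`!; set v := (2 ^ n)%N; set w := (n.+1 ^ n)%N; nia.
Qed.

(** Reversing the index turns the factors into [j / n.+1], so the product is n! divided by
    [n.+1 ^ n]. *)
Lemma prod_miss_le (R : realType) n :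
  \prod_(1 <= j < n.+1) (1 - j%:R / n.+1%:R) <= (2 ^ n)%:R^-1 :> R.
Proof.
have -> : \prod_(1 <= j < n.+1) (1 - j%:R / n.+1%:R) = n`!%:R / (n.+1 ^ n)%:R :> R.
  rewrite big_nat_rev /= fact_prod natr_prod.
  rewrite [RHS](_ : _ = \prod_(1 <= i < n.+1) (i%:R / n.+1%:R)); last first.
    by rewrite big_split /= prodr_const_nat subSS subn0 exprVn natrX.
  apply: eq_big_nat => i /andP[_ i_n]; rewrite (_ : 1 + _ - _ = n.+1 - i)%N; last by lia.
  rewrite natrB; last exact: ltnW.
  rewrite mulrBl.
  rewrite divff; last by rewrite pnatr_eq0.
  by rewrite subKr.
rewrite ler_pdivrMr ?ltr0n ?expn_gt0// mulrC ler_pdivlMr ?ltr0n ?expn_gt0//.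
by rewrite -natrM ler_nat fact_pow2_le.
Qed.

Section PositiveProbability.
Context {R : realType} {d : measure_display} {Omega : measurableType d}.
Variable P : probability Omega R.
Variable S : G -> nat -> Omega -> G.
Hypothesis walkS : forall v, simple_random_walk P v (S v).
Hypothesis indepS : mutually_independent P (fun v => sigma_process (S v)).

Definition segment (n : nat) : {fset G} :=
  [fset line_vertex j | j : nat in iota 1 n]%fset.

Definition blocked (n : nat) : set Omega :=
  joint_event (segment n) (fun v => never_hits S v (line_vertex n.+1)).

Lemma mem_segment n v :
  v \in segment n -> exists2 j : nat, (0 < j <= n)%N & v = line_vertex j.
Proof.
by move=> /imfsetP[j /=]; rewrite mem_iota => jn ->; exists j => //; lia.
Qed.

Lemma pr_blocked n : pr P (blocked n) <= (2 ^ n)%:R^-1.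
Proof.
apply: le_trans (prod_miss_le R n); rewrite (pr_joint_event walkS indepS); last first.
  by move=> v _; exact: sigma_process_never_hits.
rewrite big_imfset /=; last by move=> i j _ _ /line_vertex_inj; lia.
rewrite undup_id ?iota_uniq// /index_iota subSS subn0 big_seq [leRHS]big_seq.
apply: ler_prod => j; rewrite mem_iota pr_ge0 => jn /=.
by apply: (pr_never_hits_right walkS); lia.
Qed.

(** The path from the root to 1 and then 2 wakes the two frogs from which the activation of the
    half-line starts. *)
Let first_steps : nat -> G :=
  extend 1 (extend 0 (fun=> rootv G) (line_vertex 1%N)) (line_vertex 2%N).

Lemma pr_first_steps : 0 < pr P (cylinder (S (rootv G)) 2 first_steps).
Proof.
rewrite (pr_cylinder_extend (walkS _) neighbour_list_neighbours); last first.
  by rewrite extend_last neighbours_line// !inE eqxx.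
rewrite (pr_cylinder_extend (walkS _) neighbour_list_neighbours); last first.
  by rewrite /neighbours /= inE eqxx.
rewrite (pr_cylinder0 (walkS _)) extend_last neighbours_line//.
by rewrite size_neighbours_root mul1r mulr_gt0// invr_gt0 ltr0n.
Qed.

(** Up to null events, [C] is covered by recurrence and [stuck], and [stuck] has at most half the
    probability of [C]. *)
Lemma pr_recurrence_gt0 : 0 < pr P (recurrence_event S).
Proof.
have sM := measurable_sigma_algebra Omega.
set C := cylinder (S (rootv G)) 2 first_steps.
have mC : measurable C by exact: (srw_measurable_cylinder (walkS _)).
have mW := measurable_all_walks walkS.
have mH u a : measurable (never_hits S u a) by exact: measurable_never_hits.
have mF n : measurable (blocked n).
  by apply: (measurable_joint_event walkS) => v _; exact: sigma_process_never_hits.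
have mRec : measurable (recurrence_event S).
  apply: measurable_recurrence_event => v n x.
  exact: (measurable_srw_eq (walkS v)).
pose miss : set Omega :=
  [set w | exists j : nat, never_hits S (line_vertex j.+1) (rootv G) w].
(* Levels start at 2 because [C] itself wakes 1 and 2; the bounds [1 / 2 ^ n.+2] then sum to 1/2. *)
pose stuck : set Omega := [set w | exists n, (blocked n.+2 `&` C) w].
have mMiss : measurable miss by apply: (sigma_exists sM) => j; exact: mH.
have mStuck : measurable stuck.
  by apply: (sigma_exists sM) => n; exact: measurableI.
have miss0 : pr P miss = 0.
  by apply: pr_exists_eq0 => j //; exact: (pr_never_hits_root walkS).
have stuck_le : pr P stuck <= pr P C / 2.
  apply: (@pr_bigcup_geometric _ _ _ _ _ (fun n => blocked n.+2 `&` C)) => //.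
  - by rewrite divr_ge0// pr_ge0.
  - by move=> n; exact: measurableI.
  (* The root frog is not in the segment, so [C] is independent of [blocked n.+2]. *)
  move=> n; have -> : pr P (blocked n.+2 `&` C) = pr P (blocked n.+2) * pr P C.
    apply: (pr_joint_event_indep walkS indepS (u := rootv G)).
    - by move=> v _; exact: sigma_process_never_hits.
    - apply/negP => /mem_segment[j jn].
      by rewrite -line_vertex0 => /line_vertex_inj; lia.
    - exact: sigma_process_cylinder.
  rewrite mulrC -mulrA ler_wpM2l ?pr_ge0//.
  apply: (le_trans (pr_blocked _)).
  by rewrite -invfM -natrM -expnS.
have := pr_first_steps; rewrite -/C.
suff : pr P C <= pr P (recurrence_event S) + (pr P (~` all_walks S) +
    (pr P miss + pr P stuck)).
  by rewrite (pr_not_all_walks walkS) miss0; lra.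
have mWC : measurable (~` all_walks S) by exact: measurableC.
have mMS : measurable (miss `|` stuck) by exact: measurableU.
apply: le_trans (lerD (lexx _) (lerD (lexx _) (prU_le P mMiss mStuck))).
apply: le_trans (lerD (lexx _) (prU_le P mWC mMS)).
apply: pr_le_add => //; first exact: measurableU.
move=> w Cw; have [Ww|] := pselect (all_walks S w); last by right; left.
have [Mw|nM] := pselect (miss w); first by right; right; left.
have [Tw|nT] := pselect (stuck w); first by right; right; right.
left; apply: recurrent_line.
- by move=> v; exact: (Ww v).1.
- by rewrite Cw.
- by rewrite Cw.
- case=> [|[|n]] // _.
  have : ~ blocked n.+2 w by move=> Bw; apply: nT; exists n.
  move=> /existsNP[v /not_implyP[/mem_segment[j jn ->]]].
  by move=> /existsNP[k /contrapT]; exists j => //; exists k.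
- case=> // j _; have : ~ never_hits S (line_vertex j.+1) (rootv G) w.
    by move=> Mw; apply: nM; exists j.
  by move=> /existsNP[k /contrapT]; exists k.
Qed.

End PositiveProbability.

(** * No return without a lineage reaching the root *)

(** At a line vertex other than the root [word] is empty, so the relation holds towards the
    first-level tree vertices; no walk makes such a step. *)
Definition child (x y : G) : bool := [exists i, y == tree_vertex (i :: word x)].

(* [used] holds the frogs of the lineage so far: requiring new ones to be fresh
   makes the walks along a lineage independent. *)
Fixpoint lineage_hits (s : G -> nat -> G) (T : nat) (used : {fset G})
    (u : G) (k : nat) : Prop :=
  s u k = rootv G \/
  match T with
  | 0 => False
  | T'.+1 => lineage_hits s T' used u k.+1 \/
      exists y, [/\ child (s u k) y, s u k.+1 = y, y \notin used &
                    lineage_hits s T' (y |` used)%fset y 0]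
  end.

(** Monotonicity in the horizon lets a bound uniform in [T] pass to the union over all [T]. *)
Lemma lineage_hitsS s T used u k :
  lineage_hits s T used u k -> lineage_hits s T.+1 used u k.
Proof.
elim: T used u k => [|T IHT] used u k; first by case=> // ?; left.
case=> [|[/IHT|[y [xy sy yu /IHT]]]]; first by left.
  by right; left.
by move=> Dy; right; right; exists y.
Qed.

(** A lineage followed from the root frog at time 0 would hit at once. The first step, to [y], is
    therefore split off: either the root frog goes on from time 1, or the frog woken at [y] takes
    over. *)
Definition first_step_hits (s : G -> nat -> G) (T : nat) (y : G) : Prop :=
  lineage_hits s T [fset rootv G]%fset (rootv G) 1 \/
  y \notin [fset rootv G]%fset /\
    lineage_hits s T (y |` [fset rootv G])%fset y 0.

Section NoReturn.
Variables (s : G -> nat -> G) (i0 : 'I_6).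
Hypothesis walks : forall v, is_walk v (s v).
Hypothesis s1 : s (rootv G) 1%N = tree_vertex [:: i0].
Hypothesis no_hit : forall T, ~ first_step_hits s T (tree_vertex [:: i0]).

Let s0 v : s v 0%N = v. Proof. by case: (walks v). Qed.

(** For each awake frog, [used] is a lineage leading to it. Its members are awake, so a newly woken
    frog is fresh; no continuation of it hits the root; and the ancestors of the frog's position are
    awake, so only a step to a child can wake a frog. *)
Definition no_return_invariant (n : nat) : Prop :=
  forall u t, wake_time s n u = Some t ->
  exists used : {fset G}, exists i p,
  [/\ forall v, v \in used -> wake_time s n v <> None,
      forall T, ~ lineage_hits s T used u (n - t),
      s u (n - t)%N = tree_vertex (i :: p) &
      forall q r, i :: p = q ++ r -> wake_time s n (tree_vertex r) <> None].

Lemma wake_timeS n v : wake_time s n v <> None -> wake_time s n.+1 v <> None.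
Proof. by move=> /=; case: wake_time. Qed.

(** Time 1 is the base case, since at time 0 the initial frog sits at the root. The two frogs awake
    by then match the two alternatives of [first_step_hits]. *)
Lemma no_return_invariant1 : no_return_invariant 1.
Proof.
have wake0 u t : wake_time s 0 u = Some t -> u = rootv G /\ t = 0%N.
  by move=> /=; case: eqP => // -> [].
have suffixes q r : [:: i0] = q ++ r -> wake_time s 1 (tree_vertex r) <> None.
  case: q => [|j [|//]]; rewrite ?cat0s ?cat_cons.
    move=> <-; by have := wake_time_visit s0 (wake_time_root s 1); rewrite subn0 s1.
  by case=> _ <-; rewrite tree_vertex_nil wake_time_root.
move=> u t Wu; have [[-> ->]|[uroot -> uE]] : u = rootv G /\ t = 0%N \/
    [/\ u <> rootv G, t = 1%N & tree_vertex [:: i0] = u].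
  move: Wu => /=; case: eqP => [-> [<-]|uroot]; first by left.
  case: asboolP => // -[u' [t' [/wake0[-> ->]]]].
  by rewrite subn0 s1 => uE [<-]; right.
  exists [fset rootv G]%fset, i0, [::]; split => //.
  - by move=> v; rewrite inE => /eqP ->; rewrite wake_time_root.
  - by move=> T D; apply: (no_hit (T := T)); left.
rewrite subnn s0; exists (u |` [fset rootv G])%fset, i0, [::]; split => //.
- move=> v; rewrite !inE => /orP[/eqP ->|/eqP ->]; last by rewrite wake_time_root.
  by rewrite -uE; exact: (suffixes [::]).
- move=> T D; apply: (no_hit (T := T)); right; rewrite uE; split => //.
  by rewrite inE; apply/eqP.
Qed.

(** A frog already awake keeps its lineage; a newly woken one is appended to the lineage of a frog
    that visits it. A hit within [T] from the new state would be a hit within [T.+1] from the old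
    one. *)
Lemma no_return_invariantS n : no_return_invariant n -> no_return_invariant n.+1.
Proof.
move=> inv u t Wu.
have adj_cases u' t' i p : (t' <= n)%N -> s u' (n - t')%N = tree_vertex (i :: p) ->
    s u' (n.+1 - t')%N = tree_vertex p \/
    exists j, s u' (n.+1 - t')%N = tree_vertex (j :: i :: p).
  move=> t'n su'; have := (walks u').2 (n - t')%N.
  rewrite -subSn// su' (neighbour_list_neighbours _).2 /neighbours /= inE.
  by case/orP => [/eqP|/mapP[j _]]; [left|right; exists j].
have child_suffixes j i p : wake_time s n.+1 (tree_vertex (j :: i :: p)) <> None ->
    (forall q r, i :: p = q ++ r -> wake_time s n (tree_vertex r) <> None) ->
    forall q r, j :: i :: p = q ++ r -> wake_time s n.+1 (tree_vertex r) <> None.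
  move=> Wj suf [/= r <- //|j' q r [_ /suf]]; exact: wake_timeS.
case Wn: (wake_time s n u) => [t'|].
  have tE : t' = t by move: Wu; rewrite /= Wn => -[].
  rewrite {t'}tE in Wn.
  have [tn _] := wake_time_Some Wn.
  have [used [i [p [used_awake nD su suf]]]] := inv u t Wn.
  have nDS T : ~ lineage_hits s T used u (n.+1 - t).
    by rewrite subSn// => D; apply: (nD T.+1); right; left.
  have used_awakeS v : v \in used -> wake_time s n.+1 v <> None.
    by move=> /used_awake; exact: wake_timeS.
  case: (adj_cases u t i p tn su) => [sp|[j sj]].
    (* A parent equal to the root would be a hit at horizon 0. *)
    case: p sp su suf => [|i' p] sp su suf.
      by case: (nDS 0%N); left; rewrite sp tree_vertex_nil.
    exists used, i', p; split => // q r pqr; apply: wake_timeS.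
    by apply: (suf (i :: q)); rewrite pqr.
  exists used, j, (i :: p); split => //; apply: child_suffixes => //.
  by rewrite -sj; exact: wake_time_visit.
have [[u' [t' [Wu' su'u]]] tE] : (exists u' t', wake_time s n u' = Some t' /\
    s u' (n.+1 - t')%N = u) /\ t = n.+1.
  by move: Wu; rewrite /= Wn; case: asboolP => // -[u' [t' ?]] [<-]; split=> //; exists u', t'.
have [tn _] := wake_time_Some Wu'.
have [used [i [p [used_awake nD su' suf]]]] := inv u' t' Wu'.
(* A step to the parent cannot have woken [u], since the parent was awake at time [n]. *)
case: (adj_cases u' t' i p tn su') => [|[j sj]].
  rewrite su'u => uE; case: (suf [:: i] p erefl).
  by rewrite -uE.
have uE : u = tree_vertex (j :: i :: p) by rewrite -su'u.
have u_used : u \notin used by apply/negP => /used_awake.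
exists (u |` used)%fset, j, (i :: p); rewrite tE subnn s0; split => //.
- move=> v; rewrite in_fset1U => /orP[/eqP->|/used_awake]; last exact: wake_timeS.
  by rewrite Wu.
- move=> T D; apply: (nD T.+1); right; right; exists u; split => //.
    by apply/existsP; exists j; rewrite su' uE.
  by rewrite -subSn.
- by apply: child_suffixes => //; rewrite -uE Wu.
Qed.

Lemma no_return : ~ recurrent s.
Proof.
apply: not_recurrent => -[//|n] u _ [t Wt].
have inv : no_return_invariant n.+1.
  by elim: n {Wt} => [|n]; [exact: no_return_invariant1|exact: no_return_invariantS].
have [_ [i [p [_ _ -> _]]]] := inv u t Wt.
by rewrite -tree_vertex_nil => /tree_vertex_inj.
Qed.

End NoReturn.

(** * Recurrence has probability less than one *)

Section Transience.
Context {R : realType} {d : measure_display} {Omega : measurableType d}.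
Variable P : probability Omega R.
Variable S : G -> nat -> Omega -> G.
Hypothesis walkS : forall v, simple_random_walk P v (S v).
Hypothesis indepS : mutually_independent P (fun v => sigma_process (S v)).

Let sM := measurable_sigma_algebra Omega.
Let W := all_walks S.
Let mW : measurable W. Proof. exact: (measurable_all_walks walkS). Qed.
Let mC u n x : measurable (cylinder (S u) n x).
Proof. exact: (srw_measurable_cylinder (walkS u)). Qed.

Definition hits_event T used u k : set Omega :=
  [set w | lineage_hits (fun v n => S v n w) T used u k].

Lemma measurable_hits_event T used u k : measurable (hits_event T used u k).
Proof.
elim: T used u k => [|T IHT] used u k.
  apply: (sigma_or sM); first exact: (measurable_srw_eq (walkS u)).
  exact: (sigma_const sM).
apply: (sigma_or sM); first exact: (measurable_srw_eq (walkS u)).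
apply: (sigma_or sM); first exact: IHT.
apply: (sigma_exists sM) => y.
rewrite (_ : [set w | _] = [set w | child (S u k w) y] `&`
    [set w | S u k.+1 w = y] `&` [set w | y \notin used] `&`
    hits_event T (y |` used)%fset y 0).
  apply: measurableI; last exact: IHT.
  apply: measurableI; last exact: (sigma_const sM).
  apply: measurableI; last exact: (measurable_srw_eq (walkS u)).
  exact: (measurable_srw (walkS u) (fun x => child x y)).
by apply/seteqP; split=> w /= => [[]|[[[]]]].
Qed.

(* Summing over the moves of a frog at level [l >= 1], each step away from the
   root being counted twice because of the frog it may wake up, the weights
   [base ^+ l] decrease: [1 / (7 base) + 12 base / 7 = 97 / 98 <= 1].  Line
   vertices have an empty word, hence weight 1, and need no estimate. *)
Let base : R := 2 / 7.
Let weight (x : G) : R := base ^+ size (word x).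

Let weight_ge0 x : 0 <= weight x. Proof. by rewrite exprn_ge0// divr_ge0. Qed.

(** Here [J] holds the earlier frogs of the lineage, [E] what is known of their paths, and [u] is
    the frog followed now. Leaving [E] arbitrary lets the path of [u] join it when a new frog takes
    over, so one induction on [T] serves both moves and births. *)
Let lineage_bound (T : nat) := forall (J : {fset G}) (E : G -> set Omega) u n x,
  (forall j, j \in J -> sigma_process (S j) (E j)) -> u \notin J ->
  pr P (joint_event J E `&` cylinder (S u) n x `&`
        (hits_event T (u |` J)%fset u n `&` W)) <=
  pr P (joint_event J E) * pr P (cylinder (S u) n x) * weight (x n).

Section OneStep.
Variables (T : nat) (J : {fset G}) (E : G -> set Omega) (u : G) (n : nat).
Variable x : nat -> G.
Hypothesis boundT : lineage_bound T.
Hypothesis FE : forall j, j \in J -> sigma_process (S j) (E j).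
Hypothesis uJ : u \notin J.

Let A := joint_event J E.
Let mA : measurable A. Proof. exact: (measurable_joint_event walkS). Qed.
Let C y := cylinder (S u) n.+1 (extend n x y).
Let p : R := pr P A * pr P (cylinder (S u) n x) / (size (neighbours (x n)))%:R.

Lemma pr_move_le y : y \in neighbours (x n) ->
  pr P (A `&` C y `&` (hits_event T (u |` J)%fset u n.+1 `&` W)) <= p * weight y.
Proof.
move=> xy; apply: (le_trans (@boundT J E u n.+1 (extend n x y) FE uJ)).
rewrite (pr_cylinder_extend (walkS u) neighbour_list_neighbours xy).
by rewrite extend_last mulrA.
Qed.

(** The frog [u] joins the earlier ones, its cylinder becoming its event in [E'], and [y] starts at
    time 0 with a cylinder of probability 1. Freshness of [y] is what allows [lineage_bound] to be
    applied. *)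
Lemma pr_birth_le y : y \in neighbours (x n) -> y \notin (u |` J)%fset ->
  pr P (A `&` C y `&` (hits_event T (y |` (u |` J))%fset y 0 `&` W)) <=
  p * weight y.
Proof.
move=> xy yuJ; pose E' v := if v == u then C y else E v.
have FE' j : j \in (u |` J)%fset -> sigma_process (S j) (E' j).
  rewrite in_fset1U /E'; case: eqP => [-> _|_ /=]; last exact: FE.
  exact: sigma_process_cylinder.
have AE' : joint_event (u |` J)%fset E' = A `&` C y.
  rewrite joint_eventU1 {2}/E' eqxx; congr (_ `&` _).
  by apply: joint_event_ext => j jJ; rewrite /E'; case: eqP jJ uJ => // -> ->.
have FC : sigma_process (S u) (C y) by exact: sigma_process_cylinder.
have mAC : measurable (A `&` C y) by apply: measurableI => //; exact: mC.
have mD : measurable (hits_event T (y |` (u |` J))%fset y 0 `&` W).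
  by apply: measurableI => //; exact: measurable_hits_event.
apply: (@le_trans _ _ (pr P (A `&` C y) * weight y)).
  have := @boundT _ E' y 0%N (fun=> y) FE' yuJ.
  rewrite (pr_cylinder0 (walkS y)) mulr1 AE'; apply: le_trans.
  apply: pr_le.
  - exact: measurableI.
  - by apply: measurableI => //; exact: measurableI.
  move=> w [ACw [Dw Ww]]; do 2!split => //.
  by move=> i; rewrite leqn0 => /eqP ->; exact: (Ww y).1.
rewrite (pr_joint_event_indep walkS indepS FE uJ FC).
rewrite (pr_cylinder_extend (walkS u) neighbour_list_neighbours xy).
by rewrite mulrA.
Qed.

End OneStep.

(** At a tree vertex other than the root, either the current frog carries the lineage on, which is
    [Mv], or a child it has just visited does. The parent is counted once and each of the six
    children twice. *)
Lemma lineage_boundS T : lineage_bound T -> lineage_bound T.+1.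
Proof.
move=> boundT J E u n x FE uJ.
have mA : measurable (joint_event J E) by exact: (measurable_joint_event walkS).
have mD T' used v k : measurable (hits_event T' used v k `&` W).
  by apply: measurableI => //; exact: measurable_hits_event.
have mAC n' x' : measurable (joint_event J E `&` cylinder (S u) n' x').
  exact: measurableI.
have FC : sigma_process (S u) (cylinder (S u) n x) by exact: sigma_process_cylinder.
case xE: (x n) / (vertexP (x n)) => [i q|m]; last first.
  rewrite /weight /word /= expr0 mulr1.
  rewrite -(pr_joint_event_indep walkS indepS FE uJ FC).
  by apply: pr_le => [||w []//]; [exact: measurableI|exact: mAC].
set used := (u |` J)%fset; set kids := [seq tree_vertex (j :: i :: q) | j <- enum 'I_6].
have nbrsE : neighbours (x n) = tree_vertex q :: kids by rewrite xE.
have size_nbrs : size (neighbours (x n)) = 7%N by rewrite xE size_neighbours_tree.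
set p := pr P (joint_event J E) * pr P (cylinder (S u) n x) / 7.
have p0 : 0 <= p by rewrite divr_ge0// mulr_ge0// pr_ge0.
pose b := weight (tree_vertex q).
have b0 : 0 <= b by exact: weight_ge0.
have sum_kids (F : G -> R) : (forall y, y \in kids -> F y <= p * weight y) ->
    \sum_(y <- kids) F y <= 6 * (p * (base ^+ 2 * b)).
  move=> Fle; rewrite big_map big_enum /=.
  apply: (@le_trans _ _ (\sum_(j in 'I_6) p * (base ^+ 2 * b))).
    apply: ler_sum => j _; apply: le_trans (Fle _ _) _.
      by apply/mapP; exists j => //; rewrite mem_enum.
    by rewrite /b /weight /word /= -exprD.
  by rewrite sumr_const card_ord mulr_natl.
pose Ev := joint_event J E `&` cylinder (S u) n x `&` (hits_event T.+1 used u n `&` W).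
pose Mv := joint_event J E `&` cylinder (S u) n x `&` (hits_event T used u n.+1 `&` W).
have mEv : measurable Ev by exact: measurableI.
have mMv : measurable Mv by exact: measurableI.
have Mv_le : pr P Mv <= p * b + 6 * (p * (base ^+ 2 * b)).
  have := pr_cylinder_step walkS u n x neighbour_list_neighbours mA
    (mD T used u n.+1) (@subIsetr _ _ _).
  move=> /le_trans; apply; rewrite nbrsE big_cons.
  have move_le y : y \in neighbours (x n) -> pr P (joint_event J E `&`
      cylinder (S u) n.+1 (extend n x y) `&` (hits_event T used u n.+1 `&` W)) <=
      p * weight y.
    by move=> /(pr_move_le boundT FE uJ); rewrite size_nbrs.
  apply: lerD; first by apply: move_le; rewrite nbrsE mem_head.
  by apply: sum_kids => y ky; apply: move_le; rewrite nbrsE in_cons ky orbT.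
have birth_le : pr P (Ev `\` Mv) <= 6 * (p * (base ^+ 2 * b)).
  (* A child already in [used] cannot continue the lineage, hence the empty event. *)
  pose F y := if y \in used then set0 else joint_event J E `&`
    cylinder (S u) n.+1 (extend n x y) `&` (hits_event T (y |` used)%fset y 0 `&` W).
  have mF y : measurable (F y).
    by rewrite /F; case: ifP => // _; apply: measurableI.
  apply: (@le_trans _ _ (\sum_(y <- kids) pr P (F y))).
    apply: pr_le_sum => //; first exact: measurableD.
    move=> w [[[Aw Cw] [Dw Ww]] nMw].
    have Sn : S u n w = tree_vertex (i :: q) by rewrite Cw// xE.
    case: Dw => [|[Dw|[y [xy Sy yu Dw]]]].
    - by rewrite Sn -tree_vertex_nil => /tree_vertex_inj.
    - by case: nMw.
    exists y.
      move: xy; rewrite Sn => /existsP[j /eqP->].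
      by apply/mapP; exists j => //; rewrite mem_enum.
    by rewrite /F (negPf yu) cylinder_extend.
  apply: sum_kids => y ky; rewrite /F; case: ifPn => [_|yu].
    by rewrite pr_set0 mulr_ge0.
  have /(pr_birth_le boundT FE uJ) : y \in neighbours (x n).
    by rewrite nbrsE in_cons ky orbT.
  by rewrite size_nbrs; apply.
have : pr P Ev <= pr P Mv + pr P (Ev `\` Mv).
  apply: pr_le_add => //; first exact: measurableD.
  by move=> w Evw; have [|] := pselect (Mv w); [left|right].
move=> /le_trans; apply; apply: le_trans (lerD Mv_le birth_le) _.
have -> : pr P (joint_event J E) * pr P (cylinder (S u) n x) *
    weight (tree_vertex (i :: q)) = 7 * base * (p * b).
  by rewrite /p /b /weight /word /= exprS; field.
(* What remains is [1 + 12 * base ^+ 2 <= 7 * base], that is, 97/49 at most 2. *)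
have := mulr_ge0 p0 b0; rewrite /base => pb0.
by rewrite mulrCA; lra.
Qed.

(** Horizon 0 leaves only an immediate hit: either [x n] is the root, of weight 1, or the event is
    empty. *)
Lemma pr_lineage_hits T : lineage_bound T.
Proof.
elim: T => [|T]; last exact: lineage_boundS.
move=> J E u n x FE uJ.
have FC : sigma_process (S u) (cylinder (S u) n x) by exact: sigma_process_cylinder.
have mA : measurable (joint_event J E) by exact: (measurable_joint_event walkS).
have mD : measurable (hits_event 0 (u |` J)%fset u n `&` W).
  by apply: measurableI => //; exact: measurable_hits_event.
have mAC : measurable (joint_event J E `&` cylinder (S u) n x) by exact: measurableI.
rewrite -(pr_joint_event_indep walkS indepS FE uJ FC).
have [xr|xr] := eqVneq (x n) (rootv G).
  rewrite xr /weight /word /= expr0 mulr1.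
  by apply: pr_le => [||w []//]; [exact: measurableI|exact: mAC].
rewrite (_ : _ `&` (_ `&` _) = set0) ?pr_set0 ?mulr_ge0 ?pr_ge0//.
apply/seteqP; split=> // w [[_ Cw] [[Sr|//] _]].
by case/eqP: xr; rewrite -(Cw n).
Qed.

Let start (y : G) : set Omega :=
  cylinder (S (rootv G)) 1 (extend 0 (fun=> rootv G) y).

Lemma pr_start y : y \in neighbours (rootv G) -> pr P (start y) = 8^-1.
Proof.
move=> ry; rewrite (pr_cylinder_extend (walkS _) neighbour_list_neighbours ry).
by rewrite (pr_cylinder0 (walkS _)) size_neighbours_root mul1r.
Qed.

Lemma start_eq w y : W w -> S (rootv G) 1%N w = y -> start y w.
Proof.
move=> Ww Sy; rewrite /start cylinder_extend; split=> // i.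
by rewrite leqn0 => /eqP ->; exact: (Ww _).1.
Qed.

Let tree_hit (T : nat) : set Omega := [set w | exists i : 'I_6,
  S (rootv G) 1%N w = tree_vertex [:: i] /\
  first_step_hits (fun v n => S v n w) T (tree_vertex [:: i])] `&` W.

Lemma measurable_tree_hit T : measurable (tree_hit T).
Proof.
apply: measurableI => //; apply: (sigma_exists sM) => i.
apply: (sigma_and sM); first exact: (measurable_srw_eq (walkS _)).
apply: (sigma_or sM); first exact: measurable_hits_event.
by apply: (sigma_and sM); [exact: (sigma_const sM)|exact: measurable_hits_event].
Qed.

(** Each of the six first steps has probability 1/8 and starts two lineages at level 1, one with the
    root frog and one with the frog just woken, each of weight 2/7. *)
Lemma pr_tree_hit T : pr P (tree_hit T) <= 3 / 7.
Proof.
pose root := rootv G; pose used := [fset root]%fset.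
pose F1 y := start y `&` (hits_event T used root 1 `&` W).
pose F2 y := start y `&` (hits_event T (y |` used)%fset y 0 `&` W).
have mD used' v k : measurable (hits_event T used' v k `&` W).
  by apply: measurableI => //; exact: measurable_hits_event.
have mF1 y : measurable (F1 y) by apply: measurableI => //; exact: mC.
have mF2 y : measurable (F2 y) by apply: measurableI => //; exact: mC.
apply: (@le_trans _ _ (\sum_(j in 'I_6) (2 / 7 / 8 + 2 / 7 / 8))); last first.
  by rewrite sumr_const card_ord -mulr_natr; lra.
rewrite -big_enum /=.
apply: (@le_trans _ _ (\sum_(j <- enum 'I_6)
    pr P (F1 (tree_vertex [:: j]) `|` F2 (tree_vertex [:: j])))).
  apply: (@pr_le_sum _ _ _ _ _ _
      (fun j => F1 (tree_vertex [:: j]) `|` F2 (tree_vertex [:: j]))).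
  - exact: measurable_tree_hit.
  - by move=> j; exact: measurableU.
  move=> w [[j [Sj Hj]] Ww]; exists j; first by rewrite mem_enum.
  have Cj := start_eq Ww Sj.
  by case: Hj => [D|[_ D]]; [left|right].
apply: ler_sum => j _; apply: le_trans (prU_le P (mF1 _) (mF2 _)) _.
have ry : tree_vertex [:: j] \in neighbours root.
  rewrite neighbours_root mem_cat; apply/orP; right.
  by apply/mapP; exists j; rewrite ?mem_enum.
have E0 : joint_event (fset0 : {fset G}) (fun=> [set: Omega]) = [set: Omega].
  by apply/seteqP; split.
have FE k : k \in (fset0 : {fset G}) -> sigma_process (S k) setT by [].
have pr1 : pr P (cylinder (S root) 0 (fun=> root)) = 1 by exact: (pr_cylinder0 (walkS _)).
have prT : pr P setT = 1 by rewrite /pr probability_setT.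
have w_kid : weight (tree_vertex [:: j]) = 2 / 7 by rewrite /weight expr1.
apply: lerD.
  (* The one-step bounds hold at the root too, with no earlier frogs and the factor 1/8 in place of
     1/7. *)
  have := @pr_move_le T fset0 (fun=> setT) root 0 (fun=> root)
    (@pr_lineage_hits T) FE isT _ ry.
  rewrite E0 setTI fsetU0 pr1 prT size_neighbours_root w_kid => /le_trans; apply.
  by lra.
have := @pr_birth_le T fset0 (fun=> setT) root 0 (fun=> root)
  (@pr_lineage_hits T) FE isT _ ry.
rewrite E0 setTI fsetU0 pr1 prT size_neighbours_root w_kid inE.
have -> : (tree_vertex [:: j] == root) = false by apply/eqP => /(congr1 val).
by move=> /(_ isT) /le_trans; apply; lra.
Qed.

(** Up to a null event, recurrence forces a first step on the line, of probability 1/4, or a lineage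
    back to the root, of probability at most 3/7; together this is at most 19/28. *)
Lemma pr_recurrence_lt1 : pr P (recurrence_event S) < 1.
Proof.
have mRec : measurable (recurrence_event S).
  apply: measurable_recurrence_event => v n x.
  exact: (measurable_srw_eq (walkS v)).
pose lines := [:: line_vertex 1; line_vertex (-1)].
pose L : set Omega := [set w | exists2 y, y \in lines & start y w].
pose H : set Omega := [set w | exists T, tree_hit T w].
have mL : measurable L.
  rewrite (_ : L = start (line_vertex 1) `|` start (line_vertex (-1))).
    by apply: measurableU; exact: mC.
  apply/seteqP; split=> w => [[y]|[]].
  - by rewrite !inE => /orP[]/eqP->; [left|right].
  - by exists (line_vertex 1); rewrite ?inE ?eqxx.
  - by exists (line_vertex (-1)); rewrite ?inE ?eqxx ?orbT.
have mH : measurable H.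
  by apply: (sigma_exists sM) => T; exact: measurable_tree_hit.
have prL : pr P L <= 1 / 4.
  apply: (@le_trans _ _ (\sum_(y <- lines) pr P (start y))).
    by apply: pr_le_sum => // y; exact: mC.
  have lr y : y \in lines -> y \in neighbours (rootv G).
    by rewrite neighbours_root mem_cat => ->.
  rewrite !big_cons big_nil addr0 !pr_start ?lr ?inE ?eqxx ?orbT//.
  by lra.
have prH : pr P H <= 3 / 7.
  apply: pr_exists_nondecreasing => [T|T w [[i [Si Hi]] Ww]|T].
  - exact: measurable_tree_hit.
  - split=> //; exists i; split=> //.
    by case: Hi => [/lineage_hitsS|[iu /lineage_hitsS]]; [left|right].
  - exact: pr_tree_hit.
have mRecC : measurable (~` recurrence_event S) by exact: measurableC.
have mWC : measurable (~` W) by exact: measurableC.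
have mLH : measurable (L `|` H) by exact: measurableU.
suff : pr P setT <= pr P (~` recurrence_event S) + (pr P (~` W) +
    (pr P L + pr P H)).
  rewrite prC// (pr_not_all_walks walkS).
  have -> : pr P setT = 1 by rewrite /pr probability_setT.
  by lra.
apply: le_trans (lerD (lexx _) (lerD (lexx _) (prU_le P mL mH))).
apply: le_trans (lerD (lexx _) (prU_le P mWC mLH)).
apply: pr_le_add => //; first exact: measurableU.
move=> w _; have [Ww|] := pselect (W w); last by right; left.
have [Lw|nL] := pselect (L w); first by right; right; left.
have [Hw|nH] := pselect (H w); first by right; right; right.
left => /=.
have r1 : S (rootv G) 1%N w \in neighbours (rootv G).
  by rewrite -(neighbour_list_neighbours _).2 -{1}(Ww (rootv G)).1; exact: (Ww _).2.
have [i Si] : exists i, S (rootv G) 1%N w = tree_vertex [:: i].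
  move: r1; rewrite neighbours_root mem_cat => /orP[lr1|/mapP[i _ ->]]; last by exists i.
  by case: nL; exists (S (rootv G) 1%N w); last exact: start_eq.
apply: (no_return (i0 := i)) => // T Hi.
by apply: nH; exists T; split=> //; exists i.
Qed.

End Transience.

Theorem theorem5 (R : realType) (d : measure_display) (Omega : measurableType d)
    (P : probability Omega R) (S : T6_merge_Z -> nat -> Omega -> T6_merge_Z)
    (walkS : forall v : T6_merge_Z, simple_random_walk P v (S v))
    (indepS : mutually_independent P (fun v : T6_merge_Z => sigma_process (S v))) :
  measurable (recurrence_event S) /\
  (0 < P (recurrence_event S) < 1)%E.
Proof.
have mRec : measurable (recurrence_event S).
  apply: measurable_recurrence_event => v n x.
  exact: (measurable_srw_eq (walkS v)).
split=> //; rewrite prE// !lte_fin.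
by rewrite (pr_recurrence_gt0 walkS indepS) (pr_recurrence_lt1 walkS indepS).
Qed.
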